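(* Consider any deterministic algorithm $\mathcal{A}$ that only has access to the first-order oracle, with an initial point $\boldsymbol{x}_1\in\mathbb{R}^d$. For any positive vector $\boldsymbol{L}=[L_1,L_2,\dots,L_d]$, any $\Delta_f>0$ and any $\epsilon>0$, there exists a function $f:\mathbb{R}^d\to\mathbb{R}$ such that: (i) $f$ is coordinate-wise smooth with constants $\boldsymbol{L}$, i.e. for all $\boldsymbol{x},\boldsymbol{y}\in\mathbb{R}^d$, $|f(\boldsymbol{y})-f(\boldsymbol{x})-\langle\nabla f(\boldsymbol{x}),\boldsymbol{y}-\boldsymbol{x}\rangle|\le\sum_{i=1}^d\frac{L_i}{2}|x_i-y_i|^2$, and $f(\boldsymbol{x}_1)-\inf f\le\Delta_f$; (ii) Algorithm $\mathcal{A}$ requires more than $\frac{\|\boldsymbol{L}\|_1\Delta_f}{\epsilon^2}$ gradient queries to find a point $\hat{\boldsymbol{x}}$ with $\|\nabla f(\hat{\boldsymbol{x}})\|_1<\epsilon$.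
   Context: The algorithm $\mathcal{A}$ obtains information about $f$ only by querying the first-order oracle of $f$ at points of $\mathbb{R}^d$, starting with the initial point $\boldsymbol{x}_1$; being deterministic, each of its query points is determined by the oracle's responses to its earlier queries. Each call to the oracle counts as one gradient query. $\|\cdot\|_1$ is the $\ell_1$-norm, so $\|\boldsymbol{L}\|_1=\sum_{i=1}^dL_i$. *)

(* Defs.v *)
From HB Require Import structures.
From mathcomp Require Import all_boot all_order all_algebra.
From mathcomp Require Import all_classical all_reals all_analysis.
Import Order.TTheory GRing.Theory Num.Theory.
Import numFieldNormedType.Exports.

Set Implicit Arguments.
Unset Strict Implicit.
Unset Printing Implicit Defensive.

Local Open Scope classical_set_scope.
Local Open Scope ring_scope.

Definition l1norm (R : realType) (d : nat) (x : 'rV[R]_d) : R :=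
  \sum_(i < d) `|x 0 i|.

Definition inner (R : realType) (d : nat) (x y : 'rV[R]_d) : R :=
  \sum_(i < d) x 0 i * y 0 i.

(* 'D_v f x is a default value when f has no derivative at x along v, so this
   is meaningful only together with differentiability of f at x. *)
Definition gradient (R : realType) (d : nat) (f : 'rV[R]_d -> R)
    (x : 'rV[R]_d) : 'rV[R]_d :=
  \row_(i < d) 'D_(delta_mx 0 i) f x.

Definition coordinatewise_smooth (R : realType) (d : nat) (L : 'rV[R]_d)
    (f : 'rV[R]_d -> R) : Prop :=
  (forall x, differentiable f x) /\
  (forall x y : 'rV[R]_d,
     `|f y - f x - inner (gradient f x) (y - x)|
       <= \sum_(i < d) L 0 i / 2 * `|x 0 i - y 0 i| ^+ 2).

(* inf of a set of reals that is not bounded below is a default value, hence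
   the explicit lower bound. *)
Definition initial_gap_le (R : realType) (d : nat) (f : 'rV[R]_d -> R)
    (x1 : 'rV[R]_d) (Delta : R) : Prop :=
  has_lbound (range f) /\ f x1 - inf (range f) <= Delta.

(* A deterministic algorithm maps the sequence of oracle responses received so
   far (oldest first) to its next query point.  The earlier query points are
   themselves functions of these responses, so they need not be recorded.
   The response of the oracle of f to a query x is the gradient of f at x. *)
Definition algorithm (R : realType) (d : nat) : Type :=
  seq 'rV[R]_d -> 'rV[R]_d.

Definition starts_at (R : realType) (d : nat) (A : algorithm R d)
    (x1 : 'rV[R]_d) : Prop := A [::] = x1.

Fixpoint responses (R : realType) (d : nat) (A : algorithm R d)
    (oracle : 'rV[R]_d -> 'rV[R]_d) (t : nat) : seq 'rV[R]_d :=
  if t is t'.+1 then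
    let h := responses A oracle t' in rcons h (oracle (A h))
  else [::].

(* Counted from 0: query A oracle t is the point of the (t+1)-st oracle call. *)
Definition query (R : realType) (d : nat) (A : algorithm R d)
    (oracle : 'rV[R]_d -> 'rV[R]_d) (t : nat) : 'rV[R]_d :=
  A (responses A oracle t).

(* One of the first T gradient queries of A is made at a point whose gradient
   has l1-norm less than eps. *)
Definition finds_within (R : realType) (d : nat) (A : algorithm R d)
    (f : 'rV[R]_d -> R) (eps : R) (T : nat) : Prop :=
  exists2 t : nat, (t < T)%N &
    l1norm (gradient f (query A (gradient f) t)) < eps.

Definition requires_more_than (R : realType) (d : nat) (A : algorithm R d)
    (f : 'rV[R]_d -> R) (eps N : R) : Prop :=
  forall T : nat, finds_within A f eps T -> N < T%:R.

(* Main.v *)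
(* The resisting oracle answers every query with the same gradient
   [- eps L / |L|_1], so the first [T <= |L|_1 Delta / eps^2] queries are fixed
   in advance.  A separable [f x = - \sum_i L_i F_i (x_i)] realises these
   answers: [F_i'] is the positive part of [w - dist (t, S_i)], where
   [w = eps / |L|_1] and [S_i] collects the [i]-th coordinates of the queries.
   This is 1-Lipschitz, equals [w] on [S_i], and has integral at most [T w^2],
   so [f] decreases by at most [|L|_1 T w^2 <= Delta]. *)
Require Import Defs.
From mathcomp Require Import all_boot all_order all_algebra.
From mathcomp Require Import all_classical all_reals all_analysis.
From mathcomp Require Import ring lra.
Import Order.TTheory GRing.Theory Num.Theory.
Import numFieldNormedType.Exports.

Set Implicit Arguments.
Unset Strict Implicit.
Unset Printing Implicit Defensive.

Local Open Scope classical_set_scope.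
Local Open Scope ring_scope.

(** * One-variable calculus *)

(** After division by [h] the error is at most [C] times the absolute value of [h]. A general domain
    [V] lets this cover piecewise quadratics on the line as well as partial derivatives. *)
Lemma is_derive_quadratic (R : realType) (V : normedModType R) (f : V -> R)
    (x v : V) (c C : R) :
  (forall h, `|f (h *: v + x) - f x - h * c| <= C * h ^+ 2) ->
  is_derive x v f c.
Proof.
move=> fC.
have C0 : 0 <= C by have := fC 1; rewrite expr1n mulr1; apply: le_trans.
suff lim_f : h^-1 *: ((f \o shift x) (h *: v) - f x) @[h --> 0^'] --> c.
  by split; [apply/cvg_ex; exists c | apply: cvg_lim].
apply/cvgrPdist_le => e e0; near=> h.
have h0 : h != 0 by near: h; exact: nbhs_dnbhs_neq.
have hn0 : 0 < `|h| by rewrite normr_gt0.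
(* The denominator is [C + 1] because [C] may be 0. *)
have he : `|h| < e / (C + 1).
  near: h; apply: dnbhs0_lt; apply: divr_gt0 => //; lra.
rewrite distrC -(ler_pM2l hn0) -normrM mulrBr -[_ *: (_ - _)]/(_ * (_ - _)).
rewrite mulrA mulfV // mul1r /=.
apply: (le_trans (fC h)); rewrite -real_normK ?num_real // expr2.
move: he; rewrite ltr_pdivlMr; last lra.
nra.
Unshelve. all: by end_near.
Qed.

Lemma is_derive_continuous (R : realType) (F g : R -> R) :
  (forall x : R, is_derive x 1 F (g x)) -> continuous F.
Proof.
move=> dF x; apply/differentiable_continuous/derivable1_diffP.
exact: ex_derive.
Qed.

(** This is the mean value theorem for [G - F]. *)
Lemma is_derive_le (R : realType) (F f G g : R -> R) (a b : R) : a <= b ->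
  (forall x : R, is_derive x 1 F (f x)) ->
  (forall x : R, is_derive x 1 G (g x)) ->
  (forall x, a <= x <= b -> f x <= g x) ->
  F b - F a <= G b - G a.
Proof.
move=> ab dF dG fg.
have dGF (x : R) : is_derive x 1 (G - F) (g x - f x) by exact: is_deriveB.
have [|c cab] := @MVT_segment R (G - F) (fun x => g x - f x) a b ab
  (fun x _ => dGF x).
  exact/continuous_subspaceT/(is_derive_continuous dGF).
rewrite !fctE => eqGF.
suff : 0 <= (g c - f c) * (b - a) by lra.
by apply: mulr_ge0; rewrite subr_ge0 // fg.
Qed.

(** The parabola [Q] has a derivative lying above [g] to the right of [x] and below it to the left,
    so comparing increments works on both sides. *)
Lemma lipschitz_taylor_le (R : realType) (F g : R -> R) (x y : R) :
  (forall x : R, is_derive x 1 F (g x)) ->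
  (forall x y, `|g x - g y| <= `|x - y|) ->
  F y - F x - g x * (y - x) <= (y - x) ^+ 2 / 2.
Proof.
move=> dF lip_g.
pose Q z := g x * z + (z - x) ^+ 2 / 2.
have dQ (z : R) : is_derive z 1 Q (g x + (z - x)).
  apply: (@is_derive_quadratic _ _ _ _ _ _ (1 / 2)) => h.
  rewrite /Q [X in `|X|](_ : _ = 1 / 2 * h ^+ 2); last first.
    by rewrite /GRing.scale /=; field.
  by rewrite ger0_norm // mulr_ge0 // sqr_ge0.
suff: F y - F x <= Q y - Q x by rewrite /Q; lra.
have [xy|/ltW yx] := leP x y.
  apply: (is_derive_le xy dF dQ) => z /andP[xz _].
  have := lip_g z x; rewrite [`|z - x|]ger0_norm ?subr_ge0 // ler_norml; lra.
suff : Q x - Q y <= F x - F y by lra.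
apply: (is_derive_le yx dQ dF) => z /andP[_ zx].
have := lip_g z x; rewrite [`|z - x|]ler0_norm ?subr_le0 // ler_norml; lra.
Qed.

Lemma lipschitz_taylor (R : realType) (F g : R -> R) (x y : R) :
  (forall x : R, is_derive x 1 F (g x)) ->
  (forall x y, `|g x - g y| <= `|x - y|) ->
  `|F y - F x - g x * (y - x)| <= (y - x) ^+ 2 / 2.
Proof.
move=> dF lip_g; rewrite ler_norml lipschitz_taylor_le // andbT.
have dNF (z : R) : is_derive z 1 (- F) (- g z) by exact: is_deriveN.
have lip_Ng u v : `|- g u - - g v| <= `|u - v|.
  by rewrite -opprD normrN lip_g.
have := lipschitz_taylor_le x y dNF lip_Ng; rewrite fctE.
lra.
Qed.

Lemma lipschitz_continuous (R : realType) (g : R -> R) :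
  (forall x y, `|g x - g y| <= `|x - y|) -> continuous g.
Proof.
move=> lip_g x; apply/cvgrPdist_le => e e0; near=> y.
apply: (le_trans (lip_g x y)); near: y.
exact: cvgr_dist_le cvg_id _ e0.
Unshelve. all: by end_near.
Qed.

(** * Tents and their primitives *)

Lemma tent_primitive (R : realType) (w p : R) : 0 <= w ->
  exists P : R -> R,
    (forall x : R, is_derive x 1 P (Num.max 0 (w - `|x - p|))) /\
    (forall x y, P y - P x <= w ^+ 2).
Proof.
(* The tent is the second difference of [Num.max 0], of which [q] is a
   primitive. *)
move=> w_ge0; pose q (x : R) := Num.max 0 x ^+ 2 / 2.
have qq x h : `|q (x + h) - q x - h * Num.max 0 x| <= h ^+ 2 / 2.
  rewrite ler_norml /q.
  case: (leP 0 x) => x0; case: (leP 0 (x + h)) => xh0;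
    by apply/andP; split; nra.
exists (fun x => q (x - p + w) - 2 * q (x - p) + q (x - p - w)); split.
  (* The three errors [h ^+ 2 / 2] enter with weights 1, 2 and 1, hence the constant 2. *)
  move=> x; apply: (@is_derive_quadratic _ _ _ _ _ _ 2) => h.
  have {qq}[] := (qq (x - p + w) h, qq (x - p) h, qq (x - p - w) h).
  move=> [].
  have -> : h *: 1 + x - p + w = x - p + w + h by rewrite /GRing.scale /=; ring.
  have -> : h *: 1 + x - p - w = x - p - w + h by rewrite /GRing.scale /=; ring.
  have -> : h *: 1 + x - p = x - p + h by rewrite /GRing.scale /=; ring.
  have -> : Num.max 0 (w - `|x - p|) = Num.max 0 (x - p + w)
     - 2 * Num.max 0 (x - p) + Num.max 0 (x - p - w).
    case: (leP 0 (x - p)) => x0; [rewrite ger0_norm //|rewrite ltr0_norm //];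
      case: (leP 0 (w - _)) => ?; case: (leP 0 (x - p + w)) => ?;
      case: (leP 0 (x - p - w)) => ?; lra.
  rewrite !ler_norml.
  lra.
(* All values of the primitive lie between 0 and the area [w ^+ 2] of the tent, so no two differ by
   more. *)
have q0w x : 0 <= q (x + w) - 2 * q x + q (x - w) <= w ^+ 2.
  rewrite /q; case: (leP 0 x) => ?; case: (leP 0 (x + w)) => ?;
    case: (leP 0 (x - w)) => ?; apply/andP; split; nra.
move=> x y; have := q0w (x - p); have := q0w (y - p); lra.
Qed.

(* The positive part of [w - dist (x, s)]. *)
Definition tents (R : realType) (w : R) (s : seq R) (x : R) : R :=
  \big[Num.max/0]_(p <- s) (w - `|x - p|).

Section Tents.
Context {R : realType} (w : R) (w_ge0 : 0 <= w).

Lemma tents_ge0 s x : 0 <= tents w s x.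
Proof.
by rewrite /tents; elim/big_rec: _ => // p y _ y0; rewrite le_max y0 orbT.
Qed.

Lemma tents_peak s p : p \in s -> tents w s p = w.
Proof.
move=> ps; apply/le_anti/andP; split; last first.
  rewrite /tents; elim: s ps => // a s IH; rewrite big_cons inE le_max.
  case/orP => [/eqP <-|/IH ->]; last by rewrite orbT.
  by rewrite subrr normr0 subr0 lexx.
rewrite /tents; elim/big_rec: _ => [//|a y _ yw].
by rewrite ge_max yw andbT gerBl.
Qed.

Lemma tents_lipschitz s x y : `|tents w s x - tents w s y| <= `|x - y|.
Proof.
rewrite /tents; elim: s => [|p s]; first by rewrite !big_nil subrr normr0.
rewrite !big_cons.
have := ler_dist_dist (x - p) (y - p); rewrite opprB addrA subrK.
rewrite !ler_norml.
set u := \big[_/_]_(_ <- _) _; set v := \big[_/_]_(_ <- _) _.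
by case: (leP (w - `|x - p|) u) => ?; case: (leP (w - `|y - p|) v) => ?; lra.
Qed.

(** Bounded support will make [tents w s] integrable on the whole line, so that one integral from
    [-oo] is a primitive everywhere. *)
Lemma tents_support s : exists M : R, forall x, M < `|x| -> tents w s x = 0.
Proof.
elim: s => [|p s [M IH]]; first by exists 0 => x _; rewrite /tents big_nil.
exists (Num.max M (w + `|p|)) => x; rewrite gt_max => /andP[/IH + xw].
rewrite /tents big_cons => ->; apply/max_idPr.
by have := lerB_dist x p; lra.
Qed.

Lemma tents_primitive s :
  exists F : R -> R, forall x : R, is_derive x 1 F (tents w s x).
Proof.
pose g := tents w s.
have cont_g : continuous g by exact/lipschitz_continuous/tents_lipschitz.
have [M supp_g] := tents_support s.
pose mu := @lebesgue_measure R.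
have int_g : mu.-integrable [set: R] (EFin \o g).
  have -> : EFin \o g = (EFin \o g) \_ `[- M, M].
    apply/funext => x; rewrite patchE; case: ifPn => //.
    by rewrite mem_setE in_itv/= -ler_norml -ltNge /g /= => /supp_g ->.
  apply: (iffLR (integrable_mkcond _ _)) => //.
  apply: continuous_compact_integrable.
    exact: segment_compact.
  exact: continuous_subspaceT.
(* The endpoint [x + 1] below only serves to make [x] an interior point for the fundamental
   theorem. *)
exists (fun y => \int[mu]_(t in `]-oo, y]) g t)%R => x.
have xx1 : x < x + 1 by rewrite ltrDl.
have int_gx : mu.-integrable `]-oo, x + 1] (EFin \o g).
  exact: integrableS int_g.
have [dF eqF] := continuous_FTC1 xx1 int_gx (ltNyr x) (cont_g x).
by split => //; rewrite -derive1E.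
Qed.

(* The tents bounding [tents w s] from above have area [w ^+ 2] each. *)
Lemma tents_primitive_rise s (F : R -> R) :
  (forall x : R, is_derive x 1 F (tents w s x)) ->
  forall x y, F y - F x <= (size s)%:R * w ^+ 2.
Proof.
(* A maximum of tents is at most their sum, and [P] adds up the primitives of the single tents. *)
have [P [dP [dPP tents_le rise_P]]] : exists P dP : R -> R,
    [/\ (forall x : R, is_derive x 1 P (dP x)),
        (forall x, tents w s x <= dP x) &
        (forall x y, P y - P x <= (size s)%:R * w ^+ 2)].
  elim: s => [|p s [P [dP [dPP tents_le rise_P]]]].
    exists (fun=> 0), (fun=> 0); split=> [x|x|x y].
    - exact: is_derive_cst.
    - by rewrite /tents big_nil.
    - by rewrite mul0r subrr.
  have [Q [dQ rise_Q]] := tent_primitive p w_ge0.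
  exists (Q + P), (fun x => Num.max 0 (w - `|x - p|) + dP x); split=> [x|x|x y].
  - exact: is_deriveD.
  - rewrite /tents big_cons -/(tents w s x) ge_max.
    have := tents_le x; have := tents_ge0 s x.
    by case: (leP 0 (w - `|x - p|)) => ?; lra.
  - rewrite !fctE -natr1; have := rise_Q x y; have := rise_P x y; lra.
move=> dF x y; have [xy|/ltW yx] := leP x y.
  by apply: le_trans (rise_P x y); apply: (is_derive_le xy dF dPP).
(* Going leftwards [F] cannot rise, by comparison with a constant. *)
have : (fun=> 0 : R) x - (fun=> 0) y <= F x - F y.
  by apply: (is_derive_le yx _ dF) => z _; exact: tents_ge0.
have : 0 <= (size s)%:R * w ^+ 2 by rewrite mulr_ge0 // sqr_ge0.
rewrite /=; lra.
Qed.

End Tents.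

(** * Separable functions of several variables *)

(** Along the [j]-th axis only the [j]-th term of the sum survives, leaving a quadratic error in
    [h]. *)
Lemma gradient_quadratic (R : realType) (d : nat) (L : 'rV[R]_d)
    (f : 'rV[R]_d -> R) (x G : 'rV[R]_d) :
  (forall y, `|f y - f x - inner G (y - x)|
     <= \sum_(i < d) L 0 i / 2 * `|x 0 i - y 0 i| ^+ 2) ->
  gradient f x = G.
Proof.
move=> fG; apply/rowP => j; rewrite mxE.
apply: derive_val; apply: (@is_derive_quadratic _ _ _ _ _ _ (L 0 j / 2)) => h.
have := fG (h *: delta_mx 0 j + x).
have -> : inner G (h *: delta_mx 0 j + x - x) = h * G 0 j.
  rewrite addrK /inner (bigD1 j) //= big1 ?addr0 => [|i /negPf ij].
    by rewrite !mxE !eqxx mulr1 mulrC.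
  by rewrite !mxE eqxx ij !mulr0.
rewrite [X in _ <= X](bigD1 j) //= [X in _ <= _ + X]big1 => [|i /negPf ij].
  rewrite !mxE !eqxx mulr1 addr0 opprD addrCA subrr addr0 normrN.
  by rewrite real_normK ?num_real.
by rewrite !mxE eqxx ij mulr0 add0r subrr normr0 expr0n mulr0.
Qed.

(** The one-variable Taylor bounds, scaled by [L 0 i], add up to [fG]. This bound both identifies
    the gradient and is the smoothness estimate. *)
Lemma separable_smooth (R : realType) (d : nat) (L : 'rV[R]_d)
    (F g : 'I_d -> R -> R) :
  (forall i, 0 < L 0 i) ->
  (forall i (t : R), is_derive t 1 (F i) (g i t)) ->
  (forall i s t, `|g i s - g i t| <= `|s - t|) ->
  let f (x : 'rV[R]_d) := - \sum_(i < d) L 0 i * F i (x 0 i) in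
  coordinatewise_smooth L f /\
  forall x, gradient f x = \row_i - (L 0 i * g i (x 0 i)).
Proof.
move=> L0 dF lip_g f.
have fG x y : `|f y - f x - inner (\row_i - (L 0 i * g i (x 0 i))) (y - x)|
     <= \sum_(i < d) L 0 i / 2 * `|x 0 i - y 0 i| ^+ 2.
  rewrite /f /inner opprK [- _ + _]addrC -!sumrB.
  apply: le_trans (ler_norm_sum _ _ _) _; apply: ler_sum => i _.
  rewrite !mxE [X in `|X|](_ : _ =
    - (L 0 i * (F i (y 0 i) - F i (x 0 i) - g i (x 0 i) * (y 0 i - x 0 i)))).
    rewrite normrN normrM gtr0_norm // -mulrA ler_pM2l // [2^-1 * _]mulrC.
    by rewrite real_normK ?num_real // -sqrrN opprB lipschitz_taylor.
  by ring.
have gradE x := gradient_quadratic (fG x).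
split=> //; split=> [x|x y]; last by rewrite gradE.
(* Full differentiability comes from composing each [F i] with a coordinate projection. *)
have -> : f = - \sum_(i < d) (fun x : 'rV[R]_d => L 0 i * F i (x 0 i)).
  by apply/funext => z; rewrite fctE fct_sumE.
apply: differentiableN; apply: differentiable_sum => i.
apply: differentiableZ.
apply: (@differentiable_comp _ _ _ _ (fun x : 'rV[R]_d => x 0 i)).
  exact: differentiable_coord.
by apply/derivable1_diffP; apply: ex_derive.
Qed.

(** The points [A (nseq t G)] depend on [A] and [G] alone, so the queries can be listed before the
    function is built. *)
Lemma responses_const (R : realType) (d : nat) (A : algorithm R d)
    (oracle : 'rV[R]_d -> 'rV[R]_d) (G : 'rV[R]_d) (T : nat) :
  (forall t, (t < T)%N -> oracle (A (nseq t G)) = G) ->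
  forall t, (t <= T)%N -> responses A oracle t = nseq t G.
Proof.
move=> orG; elim=> // t IH tT.
by rewrite /= IH ?(ltnW tT) // orG // -cats1 -(nseqD _ 1) addn1.
Qed.

Theorem theorem3p3 (R : realType) (d : nat) (A : algorithm R d)
    (x1 : 'rV[R]_d) (A_x1 : starts_at A x1)
    (L : 'rV[R]_d) (Delta eps : R)
    (L_gt0 : forall i : 'I_d, 0 < L 0 i)
    (Delta_gt0 : 0 < Delta) (eps_gt0 : 0 < eps) :
  exists f : 'rV[R]_d -> R,
    [/\ coordinatewise_smooth L f,
        initial_gap_le f x1 Delta &
        requires_more_than A f eps (l1norm L * Delta / eps ^+ 2)].
Proof.
have L1E : l1norm L = \sum_(i < d) L 0 i.
  by apply: eq_bigr => i _; rewrite gtr0_norm.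
pose L1 := \sum_(i < d) L 0 i; pose N := L1 * Delta / eps ^+ 2.
have L1_ge0 : 0 <= L1 by apply: sumr_ge0 => i _; exact: ltW.
have N_ge0 : 0 <= N by rewrite divr_ge0 ?mulr_ge0 ?sqr_ge0 // ltW.
(* This [w] gives [G] the l1-norm [eps] when [L1] is nonzero. If [d = 0], then [L1], [w] and [T] are
   all 0. *)
pose w := eps / L1; pose T := Num.truncn N; pose G := \row_i - (L 0 i * w).
have w_ge0 : 0 <= w by rewrite divr_ge0 // ltW.
pose s (i : 'I_d) := [seq A (nseq t G) 0 i | t <- iota 0 T].
pose g i := tents w (s i).
have /choice[F dF] i :
    exists Fi : R -> R, forall t : R, is_derive t 1 Fi (g i t).
  exact: tents_primitive.
have lip_g i u v : `|g i u - g i v| <= `|u - v| by exact: tents_lipschitz.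
have [smooth_f gradE] := separable_smooth L_gt0 dF lip_g.
set f := fun x : 'rV[R]_d => _ in smooth_f gradE.
have fall x : f x1 - f x <= Delta.
  apply: (@le_trans _ _ (\sum_(i < d) L 0 i * (T%:R * w ^+ 2))).
    rewrite /f opprK [- _ + _]addrC -sumrB; apply: ler_sum => i _.
    rewrite -mulrBr ler_pM2l //.
    have := tents_primitive_rise w_ge0 (dF i) (x1 0 i) (x 0 i).
    by rewrite size_map size_iota.
  rewrite -mulr_suml -/L1.
  have [->|L1_neq0] := eqVneq L1 0; first by rewrite mul0r ltW.
  have L1_gt0 : 0 < L1 by rewrite lt_neqAle eq_sym L1_neq0.
  have : T%:R <= N by rewrite truncn_le.
  rewrite /N ler_pdivlMr ?exprn_gt0 // => TN.
  (* Since [L1 * w = eps], a further factor [L1] turns the total fall into [T%:R * eps ^+ 2], which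
     [TN] bounds. *)
  rewrite -(ler_pM2l L1_gt0) [X in X <= _](_ : _ = T%:R * eps ^+ 2) //.
  by rewrite /w; field.
exists f; split => //.
  have lb_f : lbound (range f) (f x1 - Delta).
    by move=> _ [x _ <-]; have := fall x; lra.
  split; first by exists (f x1 - Delta).
  have : f x1 - Delta <= inf (range f).
    by apply: lb_le_inf => //; exists (f x1), x1.
  lra.
have queried t : (t < T)%N -> gradient f (A (nseq t G)) = G.
  move=> tT; rewrite gradE; apply/rowP => i; rewrite !mxE /g tents_peak //.
  by apply: map_f; rewrite mem_iota.
move=> T' [t tT']; rewrite L1E -/L1 -/N => small.
rewrite ltNge; apply/negP => T'N.
(* At least one query was made, so [N] is at least 1; this rules out [L1 = 0]. *)
have N_gt0 : 0 < N by apply: lt_le_trans T'N; rewrite ltr0n (leq_trans _ tT').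
have L1_gt0 : 0 < L1.
  rewrite lt_neqAle L1_ge0 andbT; apply/eqP => L10.
  by move: N_gt0; rewrite /N -L10 !mul0r ltxx.
(* The integer [T'] is at most [N], hence at most its truncation [T]. *)
have tT : (t < T)%N by rewrite (leq_trans tT') // truncn_ge_nat.
move: small; rewrite /query (responses_const queried (ltnW tT)) queried //.
(* The norm is exactly [eps], which the strict inequality in [small] excludes. *)
rewrite (_ : l1norm G = eps) ?ltxx //.
rewrite /l1norm (eq_bigr (fun i => L 0 i * w)) => [|i _].
  by rewrite -mulr_suml -/L1 /w; field; lra.
by rewrite mxE normrN ger0_norm // mulr_ge0 // ltW.
Qed.
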